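(* Let $p\ge 1$ be an integer, let $c, v\in\mathbb{R}^p$ with $c^{T}v\le 0$, let $\lambda\in\mathbb{R}$ with $\lambda\ge 0$, let $j\ge 1$ be an integer, and let $\tau>0$. Define $h(t)=c^{T}v\,e^{\lambda t}t^{j}$ and $$\underline{h}(t)=\frac{c^{T}v\,e^{\lambda\tau}\tau^{j}}{\tau}\,t .$$ Then $\underline{h}(t)\le h(t)$ for all $t\in[0,\tau]$.
   Context: Here $v$ stands for either the state $x[t_k]\in\mathbb{R}^n$ or the control input $u[t_k]\in\mathbb{R}^m$ of a linear system $\dot x=Ax+Bu$ with zeroth-order-hold control, at the start of an update interval of length $\tau$. The time $t$ is measured from the start of that interval. The function $h$ is one term of the expansion of an affine predicate along the trajectory, where $\lambda$ is a real eigenvalue of $A$ and $j$ is the polynomial power coming from a Jordan block. *)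

(* Defs.v *)
From mathcomp Require Import all_boot all_order all_algebra.
From mathcomp Require Import reals sequences exp.

Set Implicit Arguments.
Unset Strict Implicit.
Unset Printing Implicit Defensive.

Import Order.TTheory GRing.Theory Num.Theory.

Local Open Scope ring_scope.

(* [c^T *m v] is a 1 x 1 matrix; the scalar c^T v is its only entry. *)
Definition dotv (R : realType) (p : nat) (c v : 'cV[R]_p) : R :=
  (c^T *m v) 0 0.

Definition hfun (R : realType) (p : nat) (c v : 'cV[R]_p) (lambda : R)
    (j : nat) (t : R) : R :=
  dotv c v * expR (lambda * t) * t ^+ j.

Definition hlow (R : realType) (p : nat) (c v : 'cV[R]_p) (lambda : R)
    (j : nat) (tau t : R) : R :=
  dotv c v * expR (lambda * tau) * tau ^+ j / tau * t.

(* Main.v *)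
Require Import Defs.
From mathcomp Require Import all_boot all_order all_algebra.
From mathcomp Require Import reals sequences exp.

Import Order.TTheory GRing.Theory Num.Theory.

Local Open Scope ring_scope.

(** Since [j >= 1], one factor [t] splits off: it remains to compare
    [c^T v e^(lambda s) s^(j-1)] at [s = tau] and [s = t], and this is
    nonincreasing in [s >= 0] because [c^T v <= 0 <= lambda]. *)
Theorem mainTheorem1 (R : realType) (p : nat) (hp : (1 <= p)%N)
    (c v : 'cV[R]_p) (hcv : dotv c v <= 0)
    (lambda : R) (hlambda : 0 <= lambda)
    (j : nat) (hj : (1 <= j)%N)
    (tau : R) (htau : 0 < tau) :
  forall t : R, 0 <= t <= tau ->
    hlow c v lambda j tau t <= hfun c v lambda j t.
Proof.
case: j hj => [//|k] _ t /andP[t0 tle].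
(* The [tau] split off from [tau ^+ k.+1] cancels the division in the slope; the common factor [t]
   can then be dropped, even when [t = 0]. *)
rewrite /hlow /hfun !exprSr !mulrA mulfK ?gt_eqF // ler_wpM2r //.
(* Removing the nonpositive factor [dotv c v] swaps the sides: the value at [t] must now be at most
   the one at [tau]. *)
rewrite -!mulrA ler_wnM2l //.
(* Both factors at [t] are nonnegative, so exponentials and powers are compared separately. *)
apply: ler_pM; rewrite ?expR_ge0 ?exprn_ge0 //.
  by rewrite ler_expR ler_wpM2l.
by rewrite lerXn2r // nnegrE ltW.
Qed.
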